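(* Let $F$ be a digraph, and for every arc $e$ of $F$ let $(a_e,b_e,r_e,q_e)$ be a tuple of integers with $q_e\ge 2$ and $\gcd(a_e,q_e)=\gcd(b_e,q_e)=1$. Then there is an integer $N$ such that the following holds. For every digraph $D$ and all sets $Z_1,Z_2\subseteq A(D)$ with $\mu(D,Z_1,Z_2)\ge N$, the digraph $D$ contains a subdigraph isomorphic to a subdivision of $F$ in which, for every arc $e$ of $F$, the branching path $P_e$ corresponding to $e$ satisfies $$a_e\,|A(P_e)\cap Z_1|+b_e\,|A(P_e)\cap Z_2|\equiv r_e \pmod{q_e}.$$
   Context: All digraphs are finite; an arc is an ordered pair $(u,v)$ of distinct vertices (both $(u,v)$ and $(v,u)$ may be present, and then they form a directed cycle of length 2). $V(D)$ and $A(D)$ denote the vertex set and arc set of a digraph $D$, and for $X\subseteq V(D)$, $D[X]$ is the subdigraph induced by $X$. For $Z_1,Z_2\subseteq A(D)$ (not necessarily disjoint), a directed cycle $C$ of $D$ is called $(Z_1,Z_2)$-unbalanced if $|A(C)\cap Z_1|\ne |A(C)\cap Z_2|$. The $(Z_1,Z_2)$-unbalanced dichromatic number $\mu(D,Z_1,Z_2)$ is the minimum number of parts in a partition $\mathcal{P}$ of $V(D)$ such that for every $P\in\mathcal{P}$ the subdigraph $D[P]$ contains no $(Z_1,Z_2)$-unbalanced directed cycle. A digraph $H$ is a subdivision of a digraph $F$ if $H$ is obtained from $F$ by replacing a set $\{e_1,\dots,e_k\}$ of arcs of $F$ by pairwise internally vertex-disjoint directed paths $P_1,\dots,P_k$ (whose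 internal vertices are new) such that if $e_i=(u,v)$ then $P_i$ is a directed path from $u$ to $v$. The branching path $P_e$ corresponding to an arc $e$ of $F$ is the directed path replacing $e$ (or the arc $e$ itself, viewed as a path of length 1, if it is not replaced). *)

(* Defs.v *)
From mathcomp Require Import all_boot.
From mathcomp Require Import boolp.

Set Implicit Arguments.
Unset Strict Implicit.
Unset Printing Implicit Defensive.

Record digraph : Type := Digraph {
  vertex :> finType;
  arc : rel vertex;
  arc_irrefl : irreflexive arc }.

Definition arcs (D : digraph) : {set D * D} := [set e | arc e.1 e.2].

(* A directed cycle is the cyclic sequence of its distinct vertices; its length
   is at least 2 because arcs are irreflexive. *)
Definition dicycle (D : digraph) (c : seq D) : bool :=
  [&& c != [::], uniq c & cycle (@arc D) c].

Definition cycle_arcs (D : digraph) (c : seq D) : {set D * D} :=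
  [set (x, next c x) | x in c].

Definition unbalanced (D : digraph) (Z1 Z2 : {set D * D}) (c : seq D) : bool :=
  dicycle c && (#|cycle_arcs c :&: Z1| != #|cycle_arcs c :&: Z2|).

(* The directed cycles of D[X] are those of D all of whose vertices are in X. *)
Definition no_unbalanced_in (D : digraph) (Z1 Z2 : {set D * D})
    (X : {set D}) : Prop :=
  forall c : seq D, {subset c <= X} -> ~~ unbalanced Z1 Z2 c.

Definition unbalanced_partition (D : digraph) (Z1 Z2 : {set D * D})
    (Q : {set {set D}}) : Prop :=
  partition Q [set: D] /\ {in Q, forall X, no_unbalanced_in Z1 Z2 X}.

Lemma unbalanced_partition_ex (D : digraph) (Z1 Z2 : {set D * D}) :
  exists n : nat,
    `[< exists Q : {set {set D}}, unbalanced_partition Z1 Z2 Q /\ #|Q| = n >].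
Proof.
pose Q := preim_partition (@id D) [set: D].
exists #|Q|; apply/asboolP; exists Q; split=> //.
have PQ : partition Q [set: D] by apply: preim_partitionP.
split=> // X XQ c cX; apply/negP=> /andP[/and3P[c0 cu cc] _].
case: c cX c0 cu cc => [|x [|y s]] //= cX _.
  by move=> _; rewrite arc_irrefl.
case/andP=> xs _ _; move: xs; rewrite inE negb_or => /andP[/eqP xy _].
case: xy.
have [z _ XE] := imsetP XQ.
have xX : x \in X by apply: cX; rewrite inE eqxx.
have yX : y \in X by apply: cX; rewrite !inE eqxx orbT.
by move: xX yX; rewrite XE !inE => /eqP <- /eqP <-.
Qed.

(* The unbalanced dichromatic number. *)
Definition mu (D : digraph) (Z1 Z2 : {set D * D}) : nat :=
  ex_minn (unbalanced_partition_ex Z1 Z2).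

(* The arcs of the directed path visiting x and then the vertices of s. *)
Definition path_arcs (T : finType) (x : T) (s : seq T) : {set T * T} :=
  [set e in zip (x :: s) s].

(* H is a subdivision of F: f u is the copy in H of the vertex u of F, and
   inn (u, v) lists the internal vertices of the branching path of the arc
   (u, v), which is the arc itself when inn (u, v) is empty. The values of inn
   outside arcs F are irrelevant. *)
Record is_subdivision (F H : digraph) (f : F -> H) (inn : F * F -> seq H) :
    Prop := IsSubdivision {
  subdiv_inj : injective f;
  subdiv_path : forall e, e \in arcs F ->
    path (@arc H) (f e.1) (rcons (inn e) (f e.2));
  subdiv_uniq : forall e, e \in arcs F -> uniq (inn e);
  subdiv_new : forall e u, e \in arcs F -> f u \notin inn e;
  subdiv_disjoint : forall e e' x, e \in arcs F -> e' \in arcs F ->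
    x \in inn e -> x \in inn e' -> e = e';
  subdiv_vertex : forall x : H,
    (exists u, x = f u) \/ (exists2 e, e \in arcs F & x \in inn e);
  subdiv_arc : forall h, h \in arcs H ->
    exists2 e, e \in arcs F & h \in path_arcs (f e.1) (rcons (inn e) (f e.2)) }.

(* g is an isomorphism from H onto a (not necessarily induced) subdigraph
   of D. *)
Definition is_embedding (H D : digraph) (g : H -> D) : Prop :=
  injective g /\ {homo g : x y / arc x y}.

(* The arc set in D of the image under g of the branching path of e. *)
Definition branching_arcs (F H D : digraph) (f : F -> H)
    (inn : F * F -> seq H) (g : H -> D) (e : F * F) : {set D * D} :=
  path_arcs (g (f e.1)) (map g (rcons (inn e) (f e.2))).

(* Main.v *)
Require Import Defs.
From mathcomp Require Import all_boot all_order all_algebra.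
From mathcomp Require Import boolp zify.
Import Order.TTheory GRing.Theory Num.Theory.

Set Implicit Arguments.
Unset Strict Implicit.
Unset Printing Implicit Defensive.

(* The arcs of F are added one at a time. Unbalancedness enters only through
   two facts: a directed cycle cannot leave the level on which it lies if the
   levels never increase along arcs, and an arc lying in exactly one of Z1, Z2
   has a weight (a, b modulo q) that generates Z_q. In a strong digraph of large
   chromatic number, an out-search followed by an in-search from the same
   vertex isolates a set, still of large chromatic number, any two vertices of
   which are joined by a path running outside the set. Repeating this with one
   more search and pigeonholing on residues gives a set X in which all ordered
   pairs x, y are joined outside X by a path of one common weight c. Now nest
   such sets and, deep inside, detour or not through one unbalanced arc between
   two consecutive links: each nesting turns the set A of available residues
   into c + (A u (A + s)) with s a generator, which is larger unless A is
   everything. After q nestings every residue is available outside a set of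
   large chromatic number, in which the rest of F is embedded by induction. *)

(* Abstracts "contains no unbalanced cycle"; stable under reversing arcs. *)
Record level_closed (T : finType) (e : rel T) (free : {set T} -> Prop) : Prop :=
  LevelClosed {
    free_sub : forall X Y : {set T}, Y \subset X -> free X -> free Y;
    free_small : forall X : {set T}, #|X| <= 1 -> free X;
    free_levels : forall (X : {set T}) (d : T -> nat),
      (forall x y, x \in X -> y \in X -> e x y -> d y <= d x) ->
      (forall i, free [set x in X | d x == i]) -> free X }.

Definition colourable (T : finType) (free : {set T} -> Prop) (k : nat)
    (X : {set T}) : Prop :=
  exists f : T -> nat, (forall x, x \in X -> f x < k) /\
    forall i, free [set x in X | f x == i].

(** Only the interior [p] lies in [S], and it may repeat vertices; [walk_link] later shortens it. *)
Definition walk (T : finType) (e : rel T) (S : {set T}) (x y : T) : Prop :=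
  exists p, path e x (rcons p y) /\ {subset p <= S}.

Definition strong (T : finType) (e : rel T) (X : {set T}) : Prop :=
  forall x y, x \in X -> y \in X ->
    exists p, [/\ path e x p, last x p = y & {subset p <= X}].

(** * Colourings, strong sets and breadth-first search *)

Section Colouring.

Variables (T : finType) (e : rel T) (free : {set T} -> Prop).
Hypothesis lc : level_closed e free.
Implicit Types (X Y : {set T}) (k : nat).

(** Subtracting [d] from its maximum reverses the order and keeps the level sets, so searches can
    also run backwards. *)
Lemma level_closed_rev : level_closed (fun x y => e y x) free.
Proof.
split; [exact: free_sub lc | exact: free_small lc | move=> X d dX lX].
pose m := \max_x d x.
have dm x : d x <= m by apply: leq_bigmax.
apply: (free_levels lc (d := fun x => m - d x)) => [x y xX yX exy|i].
  by apply: leq_sub2l; apply: dX.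
apply: (free_sub lc _ (lX (m - i))); apply/subsetP=> x; rewrite !inE.
by case/andP=> -> /eqP <- /=; rewrite subKn.
Qed.

Lemma colourable_sub k l X Y :
  Y \subset X -> k <= l -> colourable free k X -> colourable free l Y.
Proof.
move=> sYX kl [f [fk fX]]; exists f; split=> [x xY|i].
  by apply: leq_trans kl; apply: fk; apply: (subsetP sYX).
apply: (free_sub lc _ (fX i)); apply/subsetP=> x; rewrite !inE => /andP[xY ->].
by rewrite (subsetP sYX).
Qed.

Lemma colourable_card k X : #|X| <= k -> colourable free k X.
Proof.
move=> Xk; exists (fun x => index x (enum X)); split=> [x xX|i].
  by apply: leq_trans Xk; rewrite cardE index_mem mem_enum.
apply: (free_small lc); apply/card_le1_eqP => x y.
rewrite !inE => /andP[xX /eqP xi] /andP[yX /eqP yi].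
have := nth_index x (_ : x \in enum X); rewrite mem_enum => /(_ xX) <-.
by rewrite xi -yi nth_index // mem_enum.
Qed.

(** The pair of a class of [h] and a colour within it is coded as one number in base [k]. *)
Lemma colourable_fibres (A : finType) (h : T -> A) k X :
    (forall a, colourable free k [set x in X | h x == a]) ->
  colourable free (#|A| * k) X.
Proof.
move=> /choice[f fP]; exists (fun x => enum_rank (h x) * k + f (h x) x).
have fk x : x \in X -> f (h x) x < k.
  by move=> xX; apply: (proj1 (fP _)); rewrite inE xX eqxx.
split=> [x xX|i].
  apply: (@leq_trans ((enum_rank (h x)).+1 * k)).
    by rewrite mulSn addnC ltn_add2r fk.
  by rewrite leq_mul2r ltn_ord orbT.
have [->|[x0]] := set_0Vmem [set x in X | enum_rank (h x) * k + f (h x) x == i].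
  by apply: (free_small lc); rewrite cards0.
rewrite inE => /andP[x0X /eqP x0i].
apply: (free_sub lc _ (proj2 (fP (h x0)) (f (h x0) x0))).
apply/subsetP=> x; rewrite !inE => /andP[xX].
have k0 : 0 < k by apply: leq_trans (fk x0 x0X).
rewrite -x0i => /eqP E; rewrite xX /=.
have Eh : h x = h x0.
  apply/enum_rank_inj/val_inj.
  by have := congr1 (divn^~ k) E; rewrite !divnMDl // !divn_small ?addn0 ?fk.
by move: E; rewrite Eh => /addnI ->; rewrite !eqxx.
Qed.

(** No factor is lost: every level reuses the same palette, and [free_levels] glues the pieces of
    one colour. *)
Lemma colourable_levels (d : T -> nat) k X :
    (forall x y, x \in X -> y \in X -> e x y -> d y <= d x) ->
    (forall i, colourable free k [set x in X | d x == i]) ->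
  colourable free k X.
Proof.
move=> dX /choice[f fP]; exists (fun x => f (d x) x); split=> [x xX|i].
  by apply: (proj1 (fP _)); rewrite inE xX eqxx.
apply: (free_levels lc (d := d)) => [x y|j].
  by rewrite !inE => /andP[xX _] /andP[yX _]; apply: dX.
apply: (free_sub lc _ (proj2 (fP j) i)); apply/subsetP=> x; rewrite !inE.
by case/andP=> /andP[-> fi] /eqP dj; rewrite -dj fi eqxx.
Qed.

(* An inclusion-minimal set that is not k-colourable is strongly connected,
   as the vertices reachable from a vertex could be coloured independently of
   the others. *)
Lemma minimal_strong k X : ~ colourable free k X ->
  exists Y : {set T}, [/\ Y \subset X, ~ colourable free k Y & strong e Y].
Proof.
move=> hX; pose P Y := `[< ~ colourable free k Y >].
have PX : P X by apply/asboolP.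
have [Y /minsetP[/asboolP hY minY] sYX] := minset_exists PX.
exists Y; split=> // x y xY yY.
pose R := [set z in Y | `[< exists p, [/\ path e x p, last x p = z &
                                          {subset p <= Y}] >]].
have xR : x \in R by rewrite inE xY; apply/asboolP; exists [::].
have RY : R \subset Y by apply/subsetP=> z; rewrite inE => /andP[].
suff hR : ~ colourable free k R.
  have E : R = Y by apply: minY => //; apply/asboolP.
  have: y \in R by rewrite E.
  by rewrite inE => /andP[_ /asboolP].
move=> cR; apply: hY.
apply: (@colourable_levels (fun z => z \notin R)) => [z t zY tY ezt|i].
  case: (boolP (z \in R)) => [|_]; last exact: leq_b1.
  rewrite inE => /andP[_ /asboolP[p [pp lp pY]]].
  suff -> : t \in R by [].
  rewrite inE tY; apply/asboolP; exists (rcons p t); split.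
  - by rewrite rcons_path pp lp.
  - by rewrite last_rcons.
  - by move=> s; rewrite mem_rcons inE => /predU1P[->|/pY].
case: i => [|i].
  apply: (colourable_sub _ (leqnn k) cR); apply/subsetP=> z; rewrite inE.
  by case: (z \in R); rewrite ?andbF.
(* The part of [Y] outside [R] misses [x], so it is colourable by minimality. *)
apply: contrapT => hi.
have sub : [set z in Y | (z \notin R) == i.+1 :> nat] \subset Y.
  by apply/subsetP=> z; rewrite inE => /andP[].
have := minY _ (introT (asboolP _) hi) sub.
by move/setP/(_ x); rewrite inE xR andbF xY.
Qed.

Lemma strong_rev X : strong e X -> strong (fun x y => e y x) X.
Proof.
move=> strX x y xX yX; have [p [pp lp pX]] := strX y x yX xX.
exists (rev (belast y p)); rewrite -{1}lp rev_path; split=> //.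
  by case: p lp {pp pX} => [|a p] //=; rewrite rev_cons last_rcons.
move=> z; rewrite mem_rev => /mem_belast.
by rewrite inE => /predU1P[->|/pX].
Qed.

(** Levels are distances from [u]. Among levels of one parity no arc goes up, since an arc climbs at
    most one step; hence some level [L] stays hard, and the parity split costs the factor 2. A
    shortest path into [L] meets [L] only at its end. *)
Lemma bfs_level k u X Y : 0 < k -> u \in X ->
    strong e X -> Y \subset X -> ~ colourable free (2 * k) Y ->
  exists L : {set T}, [/\ L \subset Y, ~ colourable free k L, u \notin L &
    forall y, y \in L -> walk e (X :\: L) u y].
Proof.
move=> k0 uX strX sYX hY.
pose P y p := [/\ path e u p, last u p = y & {subset p <= X}].
have : forall y, exists n, y \in X ->
    (exists2 p, P y p & size p = n) /\ (forall p, P y p -> n <= size p).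
  move=> y; case: (boolP (y \in X)) => [yX|]; last by exists 0.
  have ex : exists n, `[< exists2 p, P y p & size p = n >].
    by have [p pP] := strX u y uX yX; exists (size p); apply/asboolP; exists p.
  case: (ex_minnP ex) => n /asboolP[p pP np] minn; exists n => _.
  by split; [exists p | move=> q qP; apply: minn; apply/asboolP; exists q].
case/choice=> d dP.
have dS x y : x \in X -> y \in X -> e x y -> d y <= (d x).+1.
  move=> xX yX exy; have [[p [pp lp pX] <-] _] := dP x xX.
  rewrite -(size_rcons p y); apply: (proj2 (dP y yX)); split.
  - by rewrite rcons_path pp lp.
  - by rewrite last_rcons.
  - by move=> z; rewrite mem_rcons inE => /predU1P[->|/pX].
have [b hZ] : exists b, ~ colourable free k [set y in Y | odd (d y) == b].
  apply/existsNP => cY; apply: hY; rewrite -card_bool.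
  exact: (colourable_fibres (h := odd \o d)).
set Z := [set y in Y | _] in hZ.
have sZX : {subset Z <= X} by move=> z /setIdP[zY _]; apply: (subsetP sYX).
have [i hL] : exists i, ~ colourable free k [set y in Z | d y == i].
  apply/existsNP => cZ; apply: hZ; apply: colourable_levels cZ => x y xZ yZ exy.
  have := dS x y (sZX _ xZ) (sZX _ yZ) exy.
  rewrite leq_eqVlt => /predU1P[E|//].
  move: xZ yZ; rewrite !inE E /= => /andP[_ /eqP<-] /andP[_].
  by case: (odd _).
set L := [set y in Z | _] in hL.
have sLX y : y \in L -> y \in X by case/setIdP=> /sZX.
have Ld y : y \in L -> d y = i by case/setIdP=> _ /eqP.
have i0 : 0 < i.
  case: i @L sLX Ld hL => // L sLX Ld []; apply: colourable_card.
  apply: leq_trans k0; rewrite -(cards1 u); apply: subset_leq_card.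
  apply/subsetP=> y yL; rewrite inE.
  have [[p [_ lp _] sp] _] := dP y (sLX y yL).
  by move: sp lp; rewrite (Ld y yL) => /size0nil-> /= ->.
exists L; split=> //.
- by apply/subsetP=> y /setIdP[/setIdP[]].
- apply/negP=> uL; move: i0; rewrite -(Ld u uL).
  by have := proj2 (dP u uX) [::]; rewrite leqn0 lt0n => ->.
move=> y yL; have [[p [pp lp pX] sp] _] := dP y (sLX y yL).
move: sp; rewrite Ld // => sp.
case/lastP: p pp lp pX sp => [|p z] pp.
  by move=> _ _ sp; rewrite -sp in i0.
rewrite last_rcons size_rcons => zy pX si; subst z.
exists p; split=> // t tp; rewrite in_setD pX; last first.
  by rewrite mem_rcons inE tp orbT.
rewrite andbT.
(* A vertex of [L] inside the path would have distance less than [i]. *)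
apply/negP=> tL; move: (Ld t tL); apply/eqP; rewrite neq_ltn -si.
case/splitPr: p / tp pp pX si => p1 p2 pp pX si.
apply/orP; left.
have /(_ (rcons p1 t)) := proj2 (dP t (sLX t tL)).
rewrite size_cat size_rcons /= addnS ltnS => H.
apply: leq_trans (_ : (size p1).+1 <= _); last by rewrite ltnS leq_addr.
apply: H; split.
- by move: pp; rewrite rcons_cat -cat_rcons cat_path => /andP[].
- by rewrite last_rcons.
- by move=> s sp1; apply: pX; rewrite mem_rcons inE -cat_rcons mem_cat sp1 orbT.
Qed.

Lemma walk_rev (S : {set T}) x y :
  walk (fun x y => e y x) S x y -> walk e S y x.
Proof.
case=> p [pp pS]; exists (rev p); split=> [|z]; last by rewrite mem_rev => /pS.
have := rev_path e x (rcons p y).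
by rewrite last_rcons belast_rcons rev_cons pp => ->.
Qed.

End Colouring.
Local Open Scope ring_scope.

(** * Paths with prescribed interior and weight *)

Definition weight (T : finType) (G : zmodType) (w : T * T -> G) (x : T)
  (s : seq T) : G := \sum_(h <- zip (x :: s) s) w h.

(** [uniq] and [S] constrain the interior only; the ends are kept off it by choosing [S] without
    them, and disjoint sets [S] give internally disjoint paths. *)
Definition link (T : finType) (e : rel T) (G : zmodType) (w : T * T -> G)
    (S : {set T}) (x y : T) (g : G) : Prop :=
  exists p, [/\ path e x (rcons p y), uniq p, {subset p <= S} &
    weight w x (rcons p y) = g].

Section Links.

Variables (T : finType) (e : rel T) (G : zmodType) (w : T * T -> G).
Implicit Types (S : {set T}).

Lemma weight_cat x p s :
  weight w x (p ++ s) = weight w x p + weight w (last x p) s.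
Proof.
elim: p x => [|a p IH] x; first by rewrite /weight big_nil add0r.
rewrite /weight /= !big_cons -addrA; congr (_ + _).
exact: IH.
Qed.

Lemma link_sub S S' x y g : S \subset S' -> link e w S x y g ->
  link e w S' x y g.
Proof.
move=> /subsetP sS [p [pp up pS wp]]; exists p; split=> //.
by move=> z /pS /sS.
Qed.

Lemma link_arc x y : e x y -> link e w set0 x y (w (x, y)).
Proof. by move=> exy; exists [::]; rewrite /= exy /weight /= big_seq1. Qed.

Lemma link_cat S S' x y z g h :
    [disjoint S & S'] -> z \notin S -> z \notin S' ->
    link e w S x z g -> link e w S' z y h ->
  link e w (S :|: S' :|: [set z]) x y (g + h).
Proof.
move=> dS zS zS' [p [pp up pS <-]] [q [pq uq qS <-]]; exists (p ++ z :: q).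
split.
- by rewrite rcons_cat /= -cat_rcons cat_path last_rcons pp pq.
- rewrite cat_uniq up /= uq negb_or andbT.
  apply/andP; split; last by apply: contra zS' => /qS.
  apply/andP; split; first by apply: contra zS => /pS.
  apply/hasPn=> t /qS tS'; apply: contraTN tS' => /pS tS.
  by rewrite (disjointFr dS tS).
- move=> t; rewrite mem_cat inE !inE => /or3P[/pS->|/eqP->|/qS->];
  by rewrite ?eqxx ?orbT.
- by rewrite rcons_cat /= -cat_rcons weight_cat last_rcons.
Qed.

Lemma walk_link S x y : walk e S x y -> x != y ->
  exists g, link e w (S :\ y) x y g.
Proof.
case=> p [pp pS] xy; have := last_rcons x p y.
case/shortenP: pp => q; case/lastP: q => [|q t] qq uq sq.
  by move=> /= E; rewrite E eqxx in xy.
rewrite last_rcons => E; subst t; move: uq => /= /andP[_].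
rewrite rcons_uniq => /andP[yq uq].
exists (weight w x (rcons q y)); exists q; split=> // z zq.
have zy : z != y by apply: contraNneq yq => <-.
rewrite !inE zy; apply: pS.
have : z \in rcons p y by apply: sq; rewrite mem_rcons inE zq orbT.
by rewrite mem_rcons inE (negPf zy).
Qed.

End Links.

(** * Gaining residues from unbalanced arcs *)

Section Gain.

Variables (T : finType) (e U : rel T) (free : {set T} -> Prop).
Variables (G : finZmodType) (w : T * T -> G).
Hypothesis e_irr : irreflexive e.
Hypothesis lc : level_closed e free.
Hypothesis free_noU : forall X : {set T},
  (forall x y, x \in X -> y \in X -> e x y -> ~~ U x y) -> free X.
Hypothesis genU : forall x y, e x y -> U x y ->
  forall g : G, exists m, g = w (x, y) *+ m.
Implicit Types (X Y W : {set T}) (k : nat).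

Lemma hard_neq0 k X : ~ colourable free k X -> exists x, x \in X.
Proof.
move=> hX; have [X0|[x xX]] := set_0Vmem X; last by exists x.
by case: hX; apply: (colourable_card lc); rewrite X0 cards0.
Qed.

(* Inside a set X2 any two vertices of which are joined through W minus X2,
   choose a strong set S and v in S: walking from x to v inside S along an
   in-search and from v to y outside S gives two internally disjoint paths, so
   their concatenation is a path whose weight depends only on the classes of x
   and y. *)
Lemma linked_level k W : (0 < k)%N ->
    ~ colourable free (8 * #|G| ^ 2 * k) W ->
  exists X, exists c : G, [/\ X \subset W, ~ colourable free k X &
    forall x y, x \in X -> y \in X -> x != y -> link e w (W :\: X) x y c].
Proof.
move=> k0.
have n0 : (0 < #|G|)%N by apply/card_gt0P; exists 0.
set K := (#|{: G * G}| * k)%N.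
have K0 : (0 < K)%N by rewrite muln_gt0 card_prod muln_gt0 n0 k0.
(* Three searches cost a factor 2 each, the pairs of residues [#|G| ^ 2]. *)
have -> : (8 * #|G| ^ 2 * k = 2 * (2 * (2 * K)))%N.
  by rewrite /K card_prod !mulnA mulnn.
move=> /(minimal_strong lc)[X0 [sX0 hX0 strX0]].
have [u uX0] := hard_neq0 hX0.
have K2 : (0 < 2 * K)%N by rewrite muln_gt0.
have K4 : (0 < 2 * (2 * K))%N by rewrite muln_gt0.
(* Both searches start at [u] in all of [X0]: going to [u] outside [X2] and back outside [X1] joins
   any two vertices of [X2] off [X2]. *)
have [X1 [sX1 hX1 uX1 wX1]] := bfs_level lc K4 uX0 strX0 (subxx X0) hX0.
have [X2 [sX2 hX2 uX2 wX2]] :=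
  bfs_level (level_closed_rev lc) K2 uX0 (strong_rev strX0) sX1 hX1.
have [S [sS hS strS]] := minimal_strong lc hX2.
have sSW : S \subset W.
  exact: subset_trans sS (subset_trans sX2 (subset_trans sX1 sX0)).
have [v vS] := hard_neq0 hS.
have outv y : exists g, y \in S -> y != v -> link e w (W :\: S) v y g.
  case: (boolP (y \in S)) => yS; last by exists 0.
  have [->|yv] := eqVneq y v; first by exists 0.
  have [p [pp pX]] := walk_rev (wX2 v (subsetP sS v vS)).
  have [q [pq qX]] := wX1 y (subsetP sX2 y (subsetP sS y yS)).
  suff vy : walk e (W :\: S) v y.
    have [|g b] := walk_link w vy; first by rewrite eq_sym.
    by exists g => _ _; apply: (link_sub _ b); apply: subsetDl.
  exists (p ++ u :: q); split.
    by rewrite rcons_cat /= -cat_rcons cat_path last_rcons pp pq.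
  move=> z; rewrite mem_cat inE => /or3P[/pX|/eqP->|/qX].
  - rewrite !inE => /andP[zX2 zX0]; rewrite (subsetP sX0) // andbT.
    by apply: contra zX2; apply/subsetP.
  - rewrite !inE (subsetP sX0) // andbT.
    by apply: contra uX2; apply/subsetP.
  - rewrite !inE => /andP[zX1 zX0]; rewrite (subsetP sX0) // andbT.
    apply: contra zX1; apply/subsetP.
    exact: subset_trans sS sX2.
(* This search stays inside [S], so its paths to [v] cannot meet those leaving [v], whose interiors
   avoid [S]. *)
have [L [sL hL vL wL]] :=
  bfs_level (level_closed_rev lc) K0 vS (strong_rev strS) (subxx S) hS.
have inv x : exists g, x \in L -> link e w (S :\: L :\ v) x v g.
  case: (boolP (x \in L)) => xL; last by exists 0.
  have [|g xv] := walk_link w (walk_rev (wL x xL)); last by exists g.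
  by apply: contraNneq vL => <-.
have [b bP] := choice inv; have [c cP] := choice outv.
have [[b0 c0] hX] : exists a,
    ~ colourable free k [set x in L | (b x, c x) == a].
  apply/existsNP=> cL; apply: hL; exact: (colourable_fibres lc cL).
set X := [set x in L | _] in hX.
have sXL : X \subset L by apply/subsetP=> z /setIdP[].
exists X, (b0 + c0); split=> //.
  exact: subset_trans sXL (subset_trans sL sSW).
move=> x y /setIdP[xL /eqP[bx _]] /setIdP[yL /eqP[_ cy]] xy.
have yv : y != v by apply: contraNneq vL => <-.
have yS := subsetP sL y yL.
have := link_cat _ _ _ (bP x xL) (cP y yS yv); rewrite bx cy => H.
apply: (link_sub _ (H _ _ _)).
- apply/subsetP=> z; rewrite !inE => /orP[/orP[|]|/eqP->].
  + case/and3P=> _ zL zS; rewrite (negPf zL) /=; exact: subsetP sSW z zS.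
  + case/andP=> zS ->; rewrite andbT.
    by apply: contra zS => /andP[zL _]; apply: (subsetP sL).
  + by rewrite (negPf vL) /=; apply: (subsetP sSW).
- apply/pred0P=> z; rewrite /= !inE.
  by case: (z \in S); rewrite /= ?andbF.
- by rewrite !inE eqxx.
- by rewrite !inE vS.
Qed.

(* Adding a generator s to a proper nonempty subset A of G produces a new
   element. *)
Lemma card_add_generator (A : {set G}) (s : G) :
    (forall g : G, exists m, g = s *+ m) -> A != set0 -> A != setT ->
  (#|A| < #|A :|: [set (a + s)%R | a in A]|)%N.
Proof.
move=> gens /set0Pn[a0 a0A] AT; apply: proper_card.
rewrite properEneq subsetUl andbT.
apply: contra AT => /eqP E; apply/eqP/setP=> g; rewrite inE.
have clA a : a \in A -> a + s \in A.
  by move=> aA; rewrite E inE; apply/orP; right; apply: imset_f.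
have [m gm] := gens (g - a0); rewrite -(subrK a0 g) gm addrC.
elim: m {gm} => [|m IH]; first by rewrite mulr0n addr0.
by rewrite mulrSr addrA clA.
Qed.

(** Induction on [j]. A link of weight [c] leads from [x] to [z] outside [W1]; within [W1] the
    inductive links continue from [z], or from [t] after taking the arc from [z] to [t]. This adds
    [c] to all residues and offers the shift by the weight of that arc. *)
Lemma linked_residues j k W : (1 < k)%N ->
    ~ colourable free ((16 * #|G| ^ 2) ^ j.+1 * k) W ->
  exists X, exists A : {set G}, [/\ X \subset W, ~ colourable free k X,
    (j < #|A|)%N \/ A = setT &
    forall x y g, x \in X -> y \in X -> x != y -> g \in A ->
      link e w (W :\: X) x y g].
Proof.
elim: j k W => [|j IH] k W k1 hW.
  have [||X [c [sX hX cX]]] := @linked_level k W.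
  - exact: ltnW.
  - move=> cW; apply: hW; apply: (colourable_sub lc _ _ cW) => //.
    by rewrite expn1 leq_mul2r leq_mul2r !orbT.
  exists X, [set c]; split=> //; first by left; rewrite cards1.
  by move=> x y g xX yX xy /set1P->; apply: cX.
have [||W1 [c [sW1 hW1 cW1]]] :=
    @linked_level ((16 * #|G| ^ 2) ^ j.+1 * (2 * k)) W.
- rewrite !muln_gt0 /= (ltnW k1) expn_gt0 muln_gt0 expn_gt0 /= !andbT.
  by apply/orP; left; apply/orP; left; apply/card_gt0P; exists 0.
(* Of the 16, a factor 8 pays for [linked_level] and 2 for deleting [z] and [t]. *)
- suff <- : ((16 * #|G| ^ 2) ^ j.+2 * k =
    8 * #|G| ^ 2 * ((16 * #|G| ^ 2) ^ j.+1 * (2 * k)))%N by [].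
  by rewrite (expnS _ j.+1); lia.
have [|X [A [sX hX cA lX]]] := IH _ _ _ hW1; first lia.
(* Without a [U]-arc inside it, [X] would need a single colour. *)
have [z [t [zX tX ezt Uzt]]] : exists z t, [/\ z \in X, t \in X, e z t & U z t].
  apply: contrapT => H; apply: hX; exists (fun=> 0%N).
  split=> [x _|i]; first lia.
  apply: free_noU => x y; rewrite !inE => /andP[xX _] /andP[yX _] exy.
  by apply/negP=> Uxy; apply: H; exists x, y.
pose Y := X :\: [set z; t].
have sYX : Y \subset X by apply: subsetDl.
have hY : ~ colourable free k Y.
  move=> cY; apply: hX; rewrite -card_bool.
  apply: (colourable_fibres lc (h := fun x => x \in [set z; t])) => -[].
    apply: (colourable_card lc); apply: leq_trans (_ : #|[set z; t]| <= k)%N.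
      by apply: subset_leq_card; apply/subsetP=> x /setIdP[_ /eqP->].
    by rewrite cards2; case: (z != t); lia.
  apply: (colourable_sub lc _ (leqnn k) cY); apply/subsetP=> x /setIdP[xX].
  by rewrite in_setD xX => /eqP->.
have YX x : x \in Y -> [/\ x \in X, x != z & x != t].
  by rewrite !inE negb_or => /andP[/andP[-> ->] ->].
have A0 : A != set0.
  by apply/set0Pn; case: cA => [/(leq_trans (ltn0Sn j))/card_gt0P|->] //;
     exists 0.
pose s := w (z, t).
exists Y, [set c + a | a in A :|: [set a + s | a in A]]; split.
- exact: subset_trans sYX (subset_trans sX sW1).
- by [].
- rewrite card_imset; last exact: addrI.
  have [->|AT] := eqVneq A setT.
    right; rewrite setTU; apply/setP=> g; rewrite inE; apply/imsetP.
    by exists (g - c); rewrite ?inE // addrC subrK.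
  left; case: cA => [cA|E]; last by rewrite E eqxx in AT.
  by apply: leq_ltn_trans cA _; apply: card_add_generator (genU ezt Uzt) A0 AT.
move=> x y g /YX[xX xz xt] /YX[yX yz yt] xy /imsetP[a aA ->].
have inW1 v : v \in X -> v \in W1 by apply/subsetP.
have xzc := cW1 x z (inW1 x xX) (inW1 z zX) xz.
have zW : z \in W by apply: (subsetP sW1) (inW1 z zX).
have tW : t \in W by apply: (subsetP sW1) (inW1 t tX).
have zt : z != t by apply: contraTneq ezt => ->; rewrite e_irr.
have disj (S : {set T}) : S \subset W1 -> [disjoint W :\: W1 & S].
  move=> /subsetP SW1; apply/pred0P=> v /=; rewrite inE.
  by apply/andP=> -[/andP[vW1 _] /SW1]; apply/negP.
have sWY : (W :\: W1) :|: (W1 :\: X) :|: [set z; t] \subset W :\: Y.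
  apply/subsetP=> v; rewrite in_setD in_setU => /orP[|].
    rewrite !inE => /orP[/andP[vW1 ->]|/andP[vX vW1]].
      by rewrite andbT; apply: contra vW1 => /andP[_ /inW1].
    by rewrite (negPf vX) andbF (subsetP sW1).
  by rewrite in_setD => vzt; rewrite vzt /=; move: vzt => /set2P[]->.
have zX1 : z \notin W1 :\: X by rewrite inE zX.
have tX1 : t \notin W1 :\: X by rewrite inE tX.
have zW1 : z \notin W :\: W1 by rewrite inE inW1.
move: aA; rewrite inE => /orP[aA|/imsetP[a' a'A ->]].
  have zy : link e w (W1 :\: X) z y a by apply: lX; rewrite // eq_sym.
  apply: (link_sub _ (link_cat (disj _ (subsetDl _ _)) zW1 zX1 xzc zy)).
  apply: subset_trans sWY; apply/subsetP=> v; rewrite !inE.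
  by case/orP=> [->//|->]; rewrite orbT.
have ty : link e w (W1 :\: X) t y a' by apply: lX; rewrite // eq_sym.
have d0 : [disjoint set0 & W1 :\: X] by rewrite -setI_eq0 set0I.
have zy := link_cat d0 (negbT (in_set0 t)) tX1 (link_arc w ezt) ty.
rewrite set0U in zy; rewrite [a' + s]addrC.
have dS : [disjoint W :\: W1 & W1 :\: X :|: [set t]].
  by apply: disj; rewrite subUset subsetDl sub1set inW1.
have zS : z \notin W1 :\: X :|: [set t] by rewrite in_setU in_set1 negb_or zX1.
apply: (link_sub _ (link_cat dS zW1 zS xzc zy)).
apply: subset_trans sWY; apply/subsetP=> v; rewrite !inE.
by do ![case/orP] => ->; rewrite ?orbT.
Qed.

End Gain.

(** * Linking a list of vertex pairs one at a time *)

Lemma linked_system (V : finType) (G : V * V -> finZmodType)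
    (r : forall h, G h) (s : seq (V * V)) :
    (forall h, h \in s -> h.1 != h.2) ->
  exists N, forall (T : finType) (e U : rel T) (free : {set T} -> Prop)
      (w : forall h, T * T -> G h) (W : {set T}),
    irreflexive e -> level_closed e free ->
    (forall X : {set T},
      (forall x y, x \in X -> y \in X -> e x y -> ~~ U x y) -> free X) ->
    (forall h x y, h \in s -> e x y -> U x y ->
      forall g : G h, exists m, g = w h (x, y) *+ m) ->
    ~ colourable free N W ->
  exists (f : V -> T) (inn : V * V -> seq T),
    [/\ injective f, forall u, f u \in W,
      forall h, h \in s ->
        [/\ path e (f h.1) (rcons (inn h) (f h.2)), uniq (inn h),
          {subset inn h <= W}, forall u, f u \notin inn h &
          weight (w h) (f h.1) (rcons (inn h) (f h.2)) = r h] &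
      forall h h' x, h \in s -> h' \in s -> x \in inn h -> x \in inn h' ->
        h = h'].
Proof.
elim: s => [|h0 s IH] hs.
  exists #|V| => T e U free w W _ lc _ _ hW.
  (* With fewer vertices, each could have its own colour; so [V] injects into [W]. *)
  have VW : (#|V| <= #|W|)%N.
    by rewrite leqNgt; apply/negP=> /ltnW/(colourable_card lc).
  exists (fun u => enum_val (widen_ord VW (enum_rank u))), (fun=> [::]).
  split=> // [u v /enum_val_inj/(congr1 val)/= E|u]; last exact: enum_valP.
  exact/enum_rank_inj/val_inj.
have [h hS|N IHN] := IH; first by apply: hs; rewrite inE hS orbT.
case: (boolP (h0 \in s)) => h0s.
  have mem_s h : (h \in h0 :: s) = (h \in s).
    by rewrite inE; case: eqP => // ->; rewrite h0s.
  exists N => T e U free w W e_irr lc fU gU hW.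
  have [|f [inn [injf fW innP disj]]] := IHN T e U free w W e_irr lc fU _ hW.
    by move=> h x y hS; apply: gU; rewrite mem_s.
  exists f, inn; split=> //.
    by move=> h; rewrite mem_s; apply: innP.
  by move=> h h' x; rewrite !mem_s; apply: disj.
(* With [j = #|G h0|] the case [j < #|A|] is impossible, so every residue is available; adding 2
   secures the hypothesis [1 < k]. *)
exists ((16 * #|G h0| ^ 2) ^ #|G h0|.+1 * (N + 2))%N => T e U free w W.
move=> e_irr lc fU gU hW.
have gen0 x y := gU h0 x y (mem_head h0 s).
have [|X [A [sX hX cA lX]]] := linked_residues e_irr lc fU gen0 _ hW.
  by rewrite addn2.
have AT : A = setT by case: cA => // /leq_trans/(_ (max_card _)); rewrite ltnn.
have [||f [inn [injf fX innP disj]]] := IHN T e U free w X e_irr lc fU.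
  by move=> h x y hS; apply: gU; rewrite inE hS orbT.
  by move=> cX; apply: hX; apply: (colourable_sub lc _ _ cX); rewrite ?leq_addr.
(* The remaining paths live in [X]; the path for [h0] is chosen last, with interior off [X], hence
   disjoint from them and from all [f u]. *)
have [||||p [pp up pX wp]] := lX (f h0.1) (f h0.2) (r h0); rewrite ?AT ?inE //.
  by rewrite (inj_eq injf) hs ?mem_head.
have nh0 h : h \in s -> (h == h0) = false.
  by move=> hS; apply: contraNF h0s => /eqP<-.
exists f, (fun h => if h == h0 then p else inn h); split=> //.
- by move=> u; apply: (subsetP sX).
- move=> h; rewrite inE => /predU1P[->|hS]; last first.
    have [? ? iX ? ?] := innP h hS; rewrite nh0 //; split=> //.
    by move=> x /iX; apply: (subsetP sX).
  rewrite eqxx; split=> //.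
  + by move=> x /pX; rewrite inE => /andP[].
  + by move=> u; apply/negP=> /pX; rewrite inE fX.
- have out h x : h \in s -> x \in inn h -> x \notin p.
    move=> hS; have [_ _ iX _ _] := innP h hS => /iX xX.
    by apply/negP=> /pX; rewrite inE xX.
  move=> h h' x; rewrite !inE => /predU1P[->|hS] /predU1P[->|h'S] //.
  + by rewrite eqxx nh0 // => xp /(out _ _ h'S)/negP.
  + by rewrite eqxx nh0 // => /(out _ _ hS)/negP.
  + by rewrite !nh0 //; apply: disj.
Qed.

(** * Unbalanced cycles and the unbalanced dichromatic number *)

Section Digraph.

Variables (D : digraph) (Z1 Z2 : {set D * D}).

Let U (x y : D) := ((x, y) \in Z1) != ((x, y) \in Z2).

(** Every arc of a cycle in [X] lies in both or in neither of [Z1], [Z2], so both counts agree. *)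
Lemma free_no_unbalanced_arc (X : {set D}) :
    (forall x y, x \in X -> y \in X -> Defs.arc x y -> ~~ U x y) ->
  no_unbalanced_in Z1 Z2 X.
Proof.
move=> XU c cX; rewrite negb_and -implybE; apply/implyP=> /and3P[_ uc cc].
rewrite negbK; apply/eqP/eq_card=> h; rewrite !inE; apply: andb_id2l.
case/imsetP=> x xc ->; apply/eqP; rewrite -[_ == _]negbK; apply: XU.
- exact: cX.
- by apply: cX; rewrite mem_next.
- exact: next_cycle.
Qed.

Lemma level_closed_no_unbalanced :
  level_closed (@Defs.arc D) (no_unbalanced_in Z1 Z2).
Proof.
split=> [X Y /subsetP sYX fX c cY|X X1 c cX|X d dX lX c cX].
- by apply: fX => x /cY /sYX.
- apply/negP=> /andP[/and3P[c0 uc cc] _].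
  case: c c0 uc cc cX => [|x [|y c]] //=; first by rewrite Defs.arc_irrefl.
  rewrite inE negb_or => _ /andP[/andP[xy _] _] _ cX.
  case/eqP: xy; apply: (card_le1_eqP X1); apply: cX;
    rewrite ?inE ?eqxx ?orbT //.
- case: c cX => [|x c] cX //; apply/negP=> ub.
  have cc : cycle (@Defs.arc D) (x :: c) by have /andP[/and3P[]] := ub.
  have dc : cycle (fun u v => d v <= d u)%N (x :: c).
    apply: (sub_in_cycle (P := [in X])) cc; first by move=> u v; apply: dX.
    by apply/allP=> u /cX.
  suff /negP : ~~ unbalanced Z1 Z2 (x :: c) by apply.
  apply: (lX (d x)) => u uc; rewrite inE cX //= eqn_leq.
  (* By transitivity [d] is comparable both ways between any two vertices of the cycle, hence
     constant on it. *)
  rewrite cycle_all2rel in dc; last first.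
    by move=> u1 u2 u3 H1 H2; apply: leq_trans H2 H1.
  have /allrelP dcP := dc.
  by rewrite !dcP ?mem_head.
Qed.

Lemma mu_colourable (k : nat) :
  colourable (no_unbalanced_in Z1 Z2) k [set: D] -> (mu Z1 Z2 <= k)%N.
Proof.
case=> f [fk fX]; rewrite /mu; case: ex_minnP => m _ minm.
pose Q := preim_partition f [set: D].
apply: (@leq_trans #|Q|).
  apply: minm; apply/asboolP; exists Q; split=> //; split.
    exact: preim_partitionP.
  move=> X /imsetP[x _ ->].
  apply: (free_sub level_closed_no_unbalanced _ (fX (f x))).
  by apply/subsetP=> y; rewrite !inE eq_sym.
pose g (i : 'I_k) := [set y | f y == i].
apply: leq_trans (_ : #|g @: [set: 'I_k]| <= k)%N; last first.
  by apply: leq_trans (leq_imset_card _ _) _; rewrite cardsT card_ord.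
apply/subset_leq_card/subsetP=> X /imsetP[x _ ->].
apply/imsetP; exists (Ordinal (fk x (in_setT x))); rewrite ?inE //.
by apply/setP=> y; rewrite !inE eq_sym.
Qed.

End Digraph.

(** * Residues and coprime coefficients *)

Lemma intr_Zp_eq0 (n : nat) (z : int) : (1 < n)%N ->
  (z%:~R == 0 :> 'Z_n) = (n %| z)%Z.
Proof.
move=> n1; have nat0 m : (m%:R == 0 :> 'Z_n) = (n %| m)%N.
  by rewrite -val_eqE /= val_Zp_nat.
case: z => m; first by rewrite -pmulrn nat0 dvdzE.
by rewrite NegzE mulrNz oppr_eq0 -pmulrn nat0 dvdzE abszN.
Qed.

(** Bezout gives an inverse [u] of [a]; then [g] is [g * u] copies of [a], with [g * u] read as a
    natural number. *)
Lemma Zp_coprime_generator (n : nat) (a : int) : (1 < n)%N -> gcdz a n = 1 ->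
  forall g : 'Z_n, exists m, g = a%:~R *+ m.
Proof.
move=> n1 an g; have [u [v E]] := Bezoutz a n.
have Eu : u%:~R * a%:~R = 1 :> 'Z_n.
  have /eqP : (u * a - 1)%:~R == 0 :> 'Z_n.
    rewrite intr_Zp_eq0 // -an -E opprD addrA subrr sub0r dvdzE abszN -dvdzE.
    exact: dvdz_mull.
  by rewrite intrB intrM => /eqP; rewrite subr_eq0 => /eqP.
exists (g * u%:~R : 'Z_n); rewrite -mulr_natr natr_Zp.
by rewrite mulrC -mulrA Eu mulr1.
Qed.

Lemma sum_mem_zip (T : finType) (c : int) (s : seq T) (Z : {set T}) : uniq s ->
  \sum_(h <- s) c *+ (h \in Z) = c * #|[set h in s] :&: Z|%:Z.
Proof.
move=> us; rewrite big_uniq //= (bigID [in Z]) /= addrC big1 ?add0r.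
  rewrite (eq_bigr (fun=> c)) => [|h /andP[_ ->] //].
  rewrite sumr_const -mulr_natr natz; congr (_ * Posz _).
  by apply: eq_card => h; rewrite !inE.
by move=> h /andP[_ /negPf->].
Qed.

(** * From path systems to subdivisions *)

Lemma path_zip (T : eqType) (x : T) (s : seq T) :
  path (fun u v => (u, v) \in zip (x :: s) s) x s.
Proof.
elim: s x => //= y s IH x; rewrite mem_head /=.
by apply: sub_path (IH y) => u v uv; rewrite inE uv orbT.
Qed.

Lemma zip_path (T : eqType) (e : rel T) (x : T) (s : seq T) : path e x s ->
  forall h, h \in zip (x :: s) s -> e h.1 h.2.
Proof.
elim: s x => //= y s IH x /andP[exy pys] h; rewrite inE => /predU1P[->|] //.
exact: IH.
Qed.

(** [H] keeps only the vertices and arcs on the chosen paths, since [D] may have further arcs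
    between them; the embedding is [val]. *)
Lemma subdivision_of_paths (F D : digraph) (f : F -> D) (inn : F * F -> seq D) :
    injective f ->
    (forall h, h \in arcs F ->
      [/\ path (@Defs.arc D) (f h.1) (rcons (inn h) (f h.2)), uniq (inn h) &
        forall u, f u \notin inn h]) ->
    (forall h h' x, h \in arcs F -> h' \in arcs F -> x \in inn h ->
      x \in inn h' -> h = h') ->
  exists (H : digraph) (fH : F -> H) (innH : F * F -> seq H) (g : H -> D),
    [/\ is_subdivision fH innH, is_embedding g &
      forall h, h \in arcs F -> branching_arcs fH innH g h =
        path_arcs (f h.1) (rcons (inn h) (f h.2))].
Proof.
move=> injf innP disj.
pose V := [set x | (x \in codom f) || [exists h in arcs F, x \in inn h]].
pose onpath (h : F * F) := zip (f h.1 :: rcons (inn h) (f h.2))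
  (rcons (inn h) (f h.2)).
pose e (x y : {x | x \in V}) :=
  [exists h in arcs F, (val x, val y) \in onpath h].
have e_arc x y : e x y -> Defs.arc (val x) (val y).
  case/exists_inP=> h hF; have [ph _ _] := innP h hF.
  exact: (zip_path ph).
have e_irr : irreflexive e.
  by move=> x; apply/idP=> exx; have := e_arc x x exx; rewrite Defs.arc_irrefl.
have fV u : f u \in V by rewrite inE codom_f.
pose fH u : {x | x \in V} := Sub (f u) (fV u).
pose innH h : seq {x | x \in V} := pmap insub (inn h).
have innHE h : h \in arcs F -> map val (innH h) = inn h.
  move=> hF; rewrite /innH pmap_filter; last exact: insubK.
  apply/all_filterP/allP=> x xh; rewrite isSome_insub inE.
  by apply/orP; right; apply/exists_inP; exists h.
have innHP h x : h \in arcs F -> (x \in innH h) = (val x \in inn h).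
  by move=> hF; rewrite -(innHE h hF) (mem_map val_inj).
have rE h : h \in arcs F ->
    map val (rcons (innH h) (fH h.2)) = rcons (inn h) (f h.2).
  by move=> hF; rewrite map_rcons innHE.
exists (Digraph e_irr), fH, innH, val; split.
- split.
  + by move=> u v /(congr1 val)/injf.
  + move=> h hF /=.
    have := path_zip (f h.1) (rcons (inn h) (f h.2)).
    rewrite -{3}(rE h hF) -[f h.1]/(val (fH h.1)) path_map.
    apply: sub_path => x y xy; apply/exists_inP; exists h => //.
  + move=> h hF; rewrite -(map_inj_uniq val_inj) innHE //.
    by have [_ uh _] := innP h hF; exact: uh.
  + move=> h u hF; rewrite innHP //.
    by have [_ _ nh] := innP h hF; exact: nh.
  + by move=> h h' x hF h'F; rewrite !innHP //; apply: disj.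
  + move=> x; have := valP x; rewrite inE => /orP[/codomP[u xu]|].
      by left; exists u; apply: val_inj.
    by case/exists_inP=> h hF xh; right; exists h; rewrite ?innHP.
  + move=> [x y]; rewrite inE => /exists_inP[h hF]; rewrite /onpath -rE //.
    rewrite -[f h.1]/(val (fH h.1)) -map_cons.
    have zipv (l m : seq {x | x \in V}) : zip (map val l) (map val m) =
        [seq (val p.1, val p.2) | p <- zip l m].
      by elim: l m => [|? l IH] [|? m] //=; rewrite IH.
    rewrite zipv => /mapP[[x' y'] xy /= [/val_inj-> /val_inj->]].
    by exists h; rewrite // inE.
- by split; [exact: val_inj | move=> x y; exact: e_arc].
- by move=> h hF; rewrite /branching_arcs rE.
Qed.

Theorem theorem1p2 (F : digraph) (a b r q : F * F -> int)
    (hq : forall e, e \in arcs F -> 2 <= q e)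
    (ha : forall e, e \in arcs F -> gcdz (a e) (q e) = 1)
    (hb : forall e, e \in arcs F -> gcdz (b e) (q e) = 1) :
  exists N : nat, forall (D : digraph) (Z1 Z2 : {set D * D}),
    Z1 \subset arcs D -> Z2 \subset arcs D -> (N <= mu Z1 Z2)%N ->
    exists (H : digraph) (f : F -> H) (inn : F * F -> seq H) (g : H -> D),
      [/\ is_subdivision f inn, is_embedding g &
          forall e, e \in arcs F ->
            (a e * #|branching_arcs f inn g e :&: Z1|%:Z
             + b e * #|branching_arcs f inn g e :&: Z2|%:Z = r e %[mod q e])%Z].
Proof.
have qE e : e \in arcs F -> q e = `|q e|%N.
  by move=> /hq; lia.
have q1 e : e \in arcs F -> (1 < `|q e|)%N.
  by move=> /hq; lia.
have [e|N hN] := @linked_system F (fun e => 'Z_(`|q e|))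
    (fun e => (r e)%:~R) (enum (arcs F)).
  rewrite mem_enum inE => eF; apply: contraTneq eF => ->.
  by rewrite Defs.arc_irrefl.
(* Strictly more than [N] parts rules out a colouring with [N] colours. *)
exists N.+1 => D Z1 Z2 _ _ muN.
(* An arc in exactly one of [Z1], [Z2] weighs [a e] or [b e], a generator modulo [q e]; along a path
   the weights sum to the required combination. *)
pose w e (h : D * D) : 'Z_(`|q e|) :=
  (a e *+ (h \in Z1) + b e *+ (h \in Z2))%:~R.
have [|||f [inn [injf _ innP disj]]] := hN D (@Defs.arc D)
    (fun x y => ((x, y) \in Z1) != ((x, y) \in Z2)) (no_unbalanced_in Z1 Z2)
    w [set: D] (@Defs.arc_irrefl D) (level_closed_no_unbalanced Z1 Z2).
- exact: free_no_unbalanced_arc.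
- move=> e x y; rewrite mem_enum /w => eF _.
  have gen c : gcdz c (q e) = 1 ->
      forall g : 'Z_(`|q e|), exists m, g = c%:~R *+ m.
    by rewrite {1}qE //; apply: Zp_coprime_generator; apply: q1.
  case: (_ \in Z1); case: (_ \in Z2) => //= _.
    by rewrite addr0; apply/gen/ha.
  by rewrite add0r; apply/gen/hb.
- by move=> /mu_colourable; rewrite leqNgt muN.
have [h hF|h h' x hF h'F|H [fH [innH [g [subH embg brE]]]]] :=
    @subdivision_of_paths F D f inn injf.
- by have [|pf uf _ nf _] := innP h; rewrite ?mem_enum.
- by apply: disj; rewrite mem_enum.
exists H, fH, innH, g; split=> // e eF; rewrite brE //.
have [|_ ue _ ne we] := innP e; first by rewrite mem_enum.
(* Distinct heads make the arcs of the path distinct, so the sum over the list counts a set. *)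
have us : uniq (rcons (inn e) (f e.2)) by rewrite rcons_uniq ne ue.
apply/eqP; rewrite eqz_mod_dvd qE // -intr_Zp_eq0 ?q1 // intrB subr_eq0 -we.
rewrite /weight /w -(raddf_sum (intmul 1)) big_split /=.
by rewrite !sum_mem_zip // zip_uniqr.
Qed.
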